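(* Let $A_C\in\mathbb{R}^{n\times n}$ be a companion matrix with characteristic polynomial $N(s)$ and $n$ distinct eigenvalues $\lambda_1,\dots,\lambda_n$ satisfying $\lambda_i+\lambda_j\ne0$ for all $i,j$. Let $P_C$ be the solution of $A_CP_C+P_CA_C^T=-e_ne_n^T$, and let $P_C^{-1}$ be its inverse, which satisfies the algebraic Riccati equation $P_C^{-1}A_C+A_C^TP_C^{-1}=-P_C^{-1}e_ne_n^TP_C^{-1}$. Define $$\hat P_j^{-C}=\frac{N(-\lambda_j)}{-N'(\lambda_j)}\,\mathcal{J}y_jy_j^T,\qquad \hat P_{ij}^{-C}=\frac{N(-\lambda_i^* )N(-\lambda_j)}{-N'(\lambda_i^* )N'(\lambda_j)}\cdot\frac{(y_i^* )^Ty_j^T}{\lambda_i^*+\lambda_j},$$ $$\tilde P_j^{-C}=\{\hat P_j^{-C}\}_H,\qquad P_{ij}^{-C}=\{\hat P_{ij}^{-C}\}_H .$$ Then $$P_C^{-1}=\sum_{j}\tilde P_j^{-C}=\sum_j\hat P_j^{-C}=\sum_{i,j}\hat P_{ij}^{-C},\qquad \hat P_j^{-C}=\sum_i\hat P_{ij}^{-C}$$ (all sums over $1,\dots,n$). Moreover, with $$\hat P_i^{C}=-\frac{x_ix_i^T\mathcal{J}}{N'(\lambda_i)N(-\lambda_i)},\qquad R_i=\frac{x_iy_i^T}{-N'(\lambda_i)},$$ the orthogonality condition $$\hat P_i^{C}\hat P_j^{-C}=\delta_{ij}R_i\qquad\text{for all } i,j$$ holds, and it determines these matrices uniquely: if $Q_1,\dots,Q_n\in\mathbb{C}^{n\times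 n}$ satisfy $\hat P_i^CQ_j=\delta_{ij}R_i$ for all $i,j$, then $Q_j=\hat P_j^{-C}$ for all $j$; and consequently the matrices $\hat P_{ij}^{-C}=R_i^*\hat P_j^{-C}$ are uniquely determined as well.
   Context: The companion matrix is $A_C=\begin{bmatrix}0_{(n-1)\times 1}&I_{(n-1)\times(n-1)}\\-a_0&-a_1\ \cdots\ -a_{n-1}\end{bmatrix}$ with real $a_0,\dots,a_{n-1}$, so $N(s)=\det(sI-A_C)=\sum_{k=0}^na_ks^k$ with $a_n=1$; $e_n=[0,\dots,0,1]^T$. Put $x_j=[1,\lambda_j,\lambda_j^2,\dots,\lambda_j^{n-1}]^T$ and $y_j=\lambda_j^{-n}\mathcal{H}_lx_j$, where $\mathcal{H}_l$ is the $n\times n$ lower Hankel matrix with entries $(\mathcal{H}_l)_{rc}=a_{r+c-n-1}$ if $r+c\ge n+1$ and $0$ otherwise; these are right and left eigenvectors of $A_C$ ($A_Cx_j=\lambda_jx_j$, $y_j^TA_C=\lambda_jy_j^T$). $\mathcal{J}=\mathrm{diag}(-1,(-1)^2,\dots,(-1)^n)$. $(\cdot)^*$ is the complex conjugate transpose (conjugate for scalars), so $(y_i^* )^T$ is the column vector of complex conjugates of the entries of $y_i$. $\{M\}_H=\tfrac12(M+M^* )$ is the Hermitian part, and $\delta_{ij}$ is the Kronecker symbol. The $R_i$ are the residues of the resolvent $(sI-A_C)^{-1}$ at $\lambda_i$. *)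

(* Defs.v *)
(* MathComp; R is the field of reals and R[i] (real-closed) its complex numbers. *)
From HB Require Import structures.
From mathcomp Require Export all_boot all_order all_algebra.
From mathcomp Require Export complex.
From mathcomp Require Export reals.

Set Implicit Arguments.
Unset Strict Implicit.
Unset Printing Implicit Defensive.

Export Order.TTheory GRing.Theory Num.Theory.
Local Open Scope ring_scope.
(* M ^t* is the complex conjugate transpose of M *)
Local Open Scope sesquilinear_scope.

Definition cmx (R : rcfType) m n (M : 'M[R]_(m, n)) : 'M[R[i]]_(m, n) :=
  map_mx (real_complex R) M.

(* a = (a_0, ..., a_{n-1}); row and column indices start at 0 *)
Definition companion (R : rcfType) n (a : n.-tuple R) : 'M[R]_n :=
  \matrix_(r < n, c < n)
    (if r.+1 == n then - a`_c else (c == r.+1 :> nat)%:R).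

Definition en (R : rcfType) n : 'cV[R]_n := \col_(r < n) (r.+1 == n)%:R.

(* With 1-based indices r' = r + 1 and c' = c + 1, the entry is a_{r'+c'-n-1}
   if r' + c' >= n + 1. *)
Definition lower_hankel (R : rcfType) n (a : n.-tuple R) : 'M[R]_n :=
  \matrix_(r < n, c < n)
    (if (n <= r + c + 1)%N then a`_(r + c + 1 - n) else 0).

Definition lyapunov (R : rcfType) n (a : n.-tuple R) (P : 'M[R]_n) : Prop :=
  companion a *m P + P *m (companion a)^T = - (en R n *m (en R n)^T).

Definition riccati (R : rcfType) n (a : n.-tuple R) (X : 'M[R]_n) : Prop :=
  X *m companion a + (companion a)^T *m X
    = - (X *m en R n *m (en R n)^T *m X).

Definition Npoly (R : rcfType) n (a : n.-tuple R) : {poly R[i]} :=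
  char_poly (cmx (companion a)).

Definition xvec (R : rcfType) n (l : R[i]) : 'cV[R[i]]_n :=
  \col_(r < n) l ^+ r.

Definition yvec (R : rcfType) n (a : n.-tuple R) (l : R[i]) : 'cV[R[i]]_n :=
  l ^- n *: (cmx (lower_hankel a) *m xvec n l).

Definition Jmx (R : rcfType) n : 'M[R[i]]_n :=
  diag_mx (\row_(r < n) (-1) ^+ r.+1).

Definition herm_part (R : rcfType) n (M : 'M[R[i]]_n) : 'M[R[i]]_n :=
  2^-1 *: (M + M ^t*).

(* The matrices below take the eigenvalues l, l1, l2 in place of their
   indices j, (i, j). *)

(* \hat P_j^{-C} *)
Definition hatPinv (R : rcfType) n (a : n.-tuple R) (l : R[i]) : 'M[R[i]]_n :=
  ((Npoly a).[- l] / - (Npoly a)^`().[l])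
    *: (Jmx R n *m yvec a l *m (yvec a l)^T).

(* \hat P_{ij}^{-C} *)
Definition hatPinv2 (R : rcfType) n (a : n.-tuple R) (l1 l2 : R[i]) :
    'M[R[i]]_n :=
  (((Npoly a).[- (l1^*)] * (Npoly a).[- l2])
     / - ((Npoly a)^`().[l1^*] * (Npoly a)^`().[l2]))
    *: ((l1^* + l2)^-1 *: (((yvec a l1) ^t*)^T *m (yvec a l2)^T)).

(* \tilde P_j^{-C} *)
Definition tildePinv (R : rcfType) n (a : n.-tuple R) (l : R[i]) :
    'M[R[i]]_n :=
  herm_part (hatPinv a l).

(* P_{ij}^{-C} *)
Definition Pinv2 (R : rcfType) n (a : n.-tuple R) (l1 l2 : R[i]) :
    'M[R[i]]_n :=
  herm_part (hatPinv2 a l1 l2).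

(* \hat P_i^C *)
Definition hatP (R : rcfType) n (a : n.-tuple R) (l : R[i]) : 'M[R[i]]_n :=
  - (((Npoly a)^`().[l] * (Npoly a).[- l])^-1
       *: (xvec n l *m (xvec n l)^T *m Jmx R n)).

(* R_i, the residue of (s I - companion a)^-1 at the simple eigenvalue l, in
   rank-one form: y^T x = - N'(l) for x = xvec n l and y = yvec a l. *)
Definition Rmx (R : rcfType) n (a : n.-tuple R) (l : R[i]) : 'M[R[i]]_n :=
  (- (Npoly a)^`().[l])^-1 *: (xvec n l *m (yvec a l)^T).

(* Main.v *)
Require Import Defs.
From mathcomp Require Import zify ring.
Local Open Scope complex_scope.
Local Open Scope ring_scope.
Local Open Scope sesquilinear_scope.
Set Implicit Arguments.
Unset Strict Implicit.
Unset Printing Implicit Defensive.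

(** Everything follows from one polynomial identity. Read the left eigenvector
    [y] of an eigenvalue [l] as the polynomial q(X) = sum_r y_r X^r; then
    (X - l) q(X) = - N(X) ([mul_ypoly]): q is, up to sign, the quotient of N by
    X - l given by Horner's scheme. Since y^T x_z = q(z), evaluating the identity
    at z <> l and differentiating it at l give
      y^T x_z = - N(z) / (z - l)   and   y^T x_l = - N'(l),
    while the leading coefficient gives y^T e_n = -1.

    Hence the x_i and y_i are dual bases up to scale, so that the R_i sum to the
    identity ([sum_Rmx]) and commute with the companion matrix. As J x_z = - x_{-z},
    the matrix \hat P_i^C is the rank-one matrix x_i x_{-i}^T / (N'(l_i) N(-l_i)),
    where x_{-i} stands for x at - l_i. It fails to solve the homogeneous Lyapunov
    equation only because - l_i is not an eigenvalue: A x_z = z x_z - N(z) e_n.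
    The defects add up to - e_n e_n^T because sum_i x_i / N'(l_i) = e_n, the last
    column of sum_i R_i = 1. So S = sum_i \hat P_i^C solves the Lyapunov equation
    ([lyapunov_hatP]). The solution is unique because l_i + l_j is never 0
    ([lyapunov_ker]); uniqueness also makes S real, by conjugating the equation,
    and symmetric, by transposing it.

    Because J is an involution, \hat P_i^C \hat P_j^{-C} contains the scalar
    y_j^T x_i and is therefore delta_ij R_i ([hatP_hatPinv]). Summing over i and j,
    sum_j \hat P_j^{-C} is the inverse of S; its Hermitian part is itself since S
    is real symmetric. Likewise R_i^* \hat P_j^{-C} contains the scalar
    x_i^* J y_j, which is q_j evaluated at - l_i^*, up to sign; this gives
    \hat P_ij^{-C} = R_i^* \hat P_j^{-C} ([hatPinv2E]), and the sum over i
    collapses by sum_i R_i^* = 1. Finally the orthogonality relations determine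
    their solution because sum_i \hat P_i^C is invertible ([hatP_inj]). *)

(** * The characteristic polynomial of a companion matrix *)

Definition charcoef_poly (R : rcfType) n (a : n.-tuple R) : {poly R} :=
  \poly_(k < n) a`_k + 'X^n.

Lemma size_charcoef_poly (R : rcfType) n (a : n.-tuple R) :
  size (charcoef_poly a) = n.+1.
Proof.
by rewrite /charcoef_poly addrC size_polyDl size_polyXn // ltnS size_poly.
Qed.

(** [companionmx] has dimension [(size p).-1], which equals [n] only
    propositionally; hence the cast. *)
Lemma char_poly_companion (R : rcfType) n (a : n.-tuple R) :
  char_poly (companion a) = charcoef_poly a.
Proof.
pose p := charcoef_poly a.
have sp : (size p).-1 = n by rewrite size_charcoef_poly.
have mp : p \is monic.
  by rewrite monicE lead_coefE sp coefD coef_poly ltnn coefXn eqxx add0r.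
have -> : companion a = castmx (sp, sp) (companionmx p).
  apply/matrixP => r c; rewrite castmxE !mxE /= sp.
  have -> : (r.+1 == n) = (r == n.-1 :> nat).
    by rewrite -[in RHS]eqSS prednK //; apply: leq_trans (ltn_ord r).
  rewrite coefD coef_poly ltn_ord coefXn (ltn_eqF (ltn_ord c)) addr0.
  by rewrite [in RHS](eq_sym _ (c : nat)).
rewrite -[RHS](companionmxK mp).
have castK m (e : (size p).-1 = m) :
    char_poly (castmx (e, e) (companionmx p)) = char_poly (companionmx p).
  by case: m / e.
exact: castK.
Qed.

Lemma NpolyE (R : rcfType) n (a : n.-tuple R) :
  Npoly a = map_poly (real_complex R) (charcoef_poly a).
Proof. by rewrite /Npoly /cmx -map_char_poly char_poly_companion. Qed.

Lemma coef_Npoly (R : rcfType) n (a : n.-tuple R) k :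
  (Npoly a)`_k = (a`_k)%:C + (k == n)%:R.
Proof.
rewrite NpolyE coef_map coefD coef_poly coefXn raddfD; congr (_ + _).
  by case: ltnP => // nk; rewrite nth_default // size_tuple.
by case: (k == n); rewrite ?rmorph1 ?rmorph0.
Qed.

Lemma size_Npoly (R : rcfType) n (a : n.-tuple R) : size (Npoly a) = n.+1.
Proof. by rewrite NpolyE size_map_poly size_charcoef_poly. Qed.

Lemma horner_NpolyE (R : rcfType) n (a : n.-tuple R) (z : R[i]) :
  (Npoly a).[z] = \sum_(k < n) (a`_k)%:C * z ^+ k + z ^+ n.
Proof.
rewrite horner_coef size_Npoly big_ord_recr /= coef_Npoly eqxx.
rewrite nth_default ?size_tuple // add0r mul1r; congr (_ + _).
by apply: eq_bigr => k _; rewrite coef_Npoly (ltn_eqF (ltn_ord k)) addr0.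
Qed.

(** The Hankel product sums [a_k l^(k+n-r-1)] over [k <= r], so the factor [l^-n]
    leaves the terms of [N(l)] of degree at most [r], divided by [l^(r+1)]. *)
Lemma yvecE (R : rcfType) n (a : n.-tuple R) (l : R[i]) r : l != 0 ->
  yvec a l r 0 = (\sum_(k < r.+1) (a`_k)%:C * l ^+ k) / l ^+ r.+1.
Proof.
move=> l0; have rn := ltn_ord r; rewrite !mxE.
have lV m : l ^+ m != 0 by rewrite expf_neq0.
rewrite mulrC; apply: (mulIf (lV n)); rewrite mulfVK //.
have -> : l ^+ n = l ^+ r.+1 * l ^+ (n - r.+1).
  by rewrite -exprD subnKC.
rewrite mulrA mulfVK // mulr_suml.
under eq_bigr do rewrite !mxE.
rewrite -(big_mkord xpredT (fun c => (if (n <= r + c + 1)%N then a`_(r + c + 1 - n)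
  else 0)%:C * l ^+ c)).
(* the Hankel entries vanish for c < n - r - 1 *)
rewrite (@big_cat_nat _ _ _ (n - r.+1)) ?leq_subr //= big_nat big1 ?add0r.
  rewrite -{1}[(n - r.+1)%N]add0n big_addn.
  have -> : (n - (n - r.+1) = r.+1)%N by lia.
  rewrite big_mkord; apply: eq_bigr => k _.
  have -> : (n <= r + (k + (n - r.+1)) + 1)%N by lia.
  have -> : (r + (k + (n - r.+1)) + 1 - n = k)%N by lia.
  by rewrite exprD mulrA.
move=> c /= cn; have -> : (n <= r + c + 1)%N = false by lia.
by rewrite rmorph0 mul0r.
Qed.

(** * The quotient of the characteristic polynomial by an eigenvalue factor *)

(** The polynomial whose coefficients are the entries of [yvec a l] when [l] is
    nonzero; it is minus the quotient of [Npoly a] by ['X - l] when [l] is a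
    root. *)
Definition ypoly (R : rcfType) n (a : n.-tuple R) (l : R[i]) : {poly R[i]} :=
  \poly_(r < n) ((\sum_(k < r.+1) (a`_k)%:C * l ^+ k) / l ^+ r.+1).

(** The coefficients [c_r] of [ypoly a l] satisfy [l c_(r+1) = c_r + a_(r+1)] and
    [l c_0 = a_0]; in degree [n] the claim is [c_(n-1) = -1], which is [N(l) = 0]
    divided by [l^n]. *)
Lemma mul_ypoly (R : rcfType) n (a : n.-tuple R) (l : R[i]) :
  l != 0 -> root (Npoly a) l -> ('X - l%:P) * ypoly a l = - Npoly a.
Proof.
move=> l0 Nl; have n0 : (0 < n)%N.
  have N0 : Npoly a != 0 by rewrite -size_poly_gt0 size_Npoly.
  have := max_poly_roots (rs := [:: l]) N0.
  by rewrite size_Npoly ltnS /= andbT; apply.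
apply/polyP => k; rewrite mulrBl coefB coefXM coefCM coefN coef_Npoly.
rewrite !coef_poly.
case: k => [|k] /=.
  rewrite n0 (ltn_eqF n0) big_ord1 expr0 mulr1 expr1 addr0 sub0r.
  by rewrite mulrCA mulfV ?mulr1.
have lk : l ^+ k.+1 != 0 by rewrite expf_neq0.
case: (ltngtP k.+1 n) => kn.
- rewrite [X in l * (X / _)]big_ord_recr [l ^+ k.+2]exprS /= addr0.
  move: (l ^+ k.+1) lk => w w0; rewrite [l * (_ / _)]mulrCA invfM mulVKf //.
  by rewrite mulrDl mulfK // opprD addrA subrr sub0r.
- rewrite nth_default ?size_tuple; last exact: ltnW.
  by rewrite !(mulr0, subr0, addr0) oppr0.
- have lk' : \sum_(j < k.+1) (a`_j)%:C * l ^+ j = - l ^+ k.+1.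
    move/rootP: Nl; rewrite horner_NpolyE kn => /eqP.
    by rewrite addr_eq0 => /eqP.
  by rewrite lk' mulr0 subr0 mulNr mulfV // nth_default ?size_tuple ?kn // add0r.
Qed.

Lemma horner_ypoly (R : rcfType) n (a : n.-tuple R) (l z : R[i]) :
  l != 0 -> (yvec a l)^T *m xvec n z = ((ypoly a l).[z])%:M.
Proof.
move=> l0; rewrite [LHS]mx11_scalar; congr (_%:M).
rewrite mxE horner_poly; apply: eq_bigr => r _.
by rewrite !mxE -yvecE // !mxE.
Qed.

Lemma ypoly_off (R : rcfType) n (a : n.-tuple R) (l z : R[i]) :
  l != 0 -> root (Npoly a) l -> z != l ->
  (ypoly a l).[z] = - (Npoly a).[z] / (z - l).
Proof.
move=> l0 Nl zl; have /(congr1 (horner^~ z)) := mul_ypoly l0 Nl.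
rewrite /= hornerN hornerM hornerXsubC => <-.
by rewrite mulrC mulKf // subr_eq0.
Qed.

Lemma ypoly_diag (R : rcfType) n (a : n.-tuple R) (l : R[i]) :
  l != 0 -> root (Npoly a) l -> (ypoly a l).[l] = - (Npoly a)^`().[l].
Proof.
move=> l0 Nl; have /(congr1 (fun p => p^`().[l])) := mul_ypoly l0 Nl.
rewrite /= derivN hornerN => <-.
by rewrite derivM derivXsubC mul1r hornerD hornerM hornerXsubC subrr mul0r addr0.
Qed.

(** The last entry of the left eigenvector is the leading coefficient of [ypoly a l],
    which [mul_ypoly] compares with that of [- N]. *)
Lemma yvec_last (R : rcfType) n (a : n.-tuple R) (l : R[i]) :
  l != 0 -> root (Npoly a) l -> (yvec a l)^T *m cmx (en R n) = (-1)%:M.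
Proof.
move=> l0 Nl; rewrite [LHS]mx11_scalar; congr (_%:M).
case: n a Nl => [|n] a Nl.
  by move: Nl; rewrite rootE horner_NpolyE big_ord0 add0r oner_eq0.
have := mul_ypoly l0 Nl.
rewrite mxE big_ord_recr big1 /= => [|r _]; last first.
  by rewrite !mxE /= eqSS (ltn_eqF (ltn_ord r)) rmorph0 mulr0.
move/(congr1 (fun p : {poly _} => p`_n.+1)).
rewrite mulrBl coefB coefXM coefCM coefN coef_Npoly !coef_poly /= ltnn ltnSn.
rewrite eqxx nth_default ?size_tuple // mulr0 subr0 add0r => <-.
by rewrite add0r mxE yvecE // !mxE /= eqxx rmorph1 mulr1.
Qed.

(** * Companion and sign matrices on Vandermonde vectors *)

(** The last row of the companion matrix sends [xvec n z] to [z^n - N(z)], so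
    [N(z)] measures how far [xvec n z] is from being an eigenvector. *)
Lemma companion_xvec (R : rcfType) n (a : n.-tuple R) (z : R[i]) :
  cmx (companion a) *m xvec n z
    = z *: xvec n z - (Npoly a).[z] *: cmx (en R n).
Proof.
apply/colP => r; rewrite !mxE; case: eqP => [rn|rn].
  rewrite rmorph1 mulr1 -exprS rn horner_NpolyE opprD addrCA subrr addr0 -sumrN.
  by apply: eq_bigr => c _; rewrite !mxE rn eqxx rmorphN mulNr.
rewrite rmorph0 mulr0 subr0 -exprS.
have rn' : (r.+1 < n)%N by move: (ltn_ord r) => /=; lia.
rewrite (bigD1 (Ordinal rn')) //= !mxE big1 ?addr0 => [|c cr].
  by move/eqP/negPf: rn => ->; rewrite eqxx rmorph1 mul1r.
rewrite !mxE; move/eqP/negPf: rn => ->.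
rewrite -val_eqE /= in cr; by rewrite (negPf cr) rmorph0 mul0r.
Qed.

(** This is why the values [N(- l)] enter the formulas. *)
Lemma Jmx_xvec (R : rcfType) n (z : R[i]) :
  Jmx R n *m xvec n z = - xvec n (- z).
Proof.
apply/colP => r; rewrite mul_diag_mx !mxE exprS [in RHS]exprNn; ring.
Qed.

Lemma Jmx_sqr (R : rcfType) n : Jmx R n *m Jmx R n = 1%:M.
Proof.
rewrite mulmx_diag; apply/matrixP => r c; rewrite !mxE; congr (_ *+ _).
by rewrite -exprD addnn -mul2n exprM sqrrN expr1n expr1n.
Qed.

Lemma trmx_Jmx (R : rcfType) n : (Jmx R n)^T = Jmx R n.
Proof. exact: tr_diag_mx. Qed.

(** * Rank-one matrices and the Lyapunov operator *)

(** This is [linearZ] for transposition, with the scaling structure fixed by [K]. *)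
Lemma trmxZ (K : pzRingType) m n (c : K) (M : 'M[K]_(m, n)) :
  (c *: M)^T = c *: M^T.
Proof. by apply/matrixP => i j; rewrite !mxE. Qed.

Lemma scaler_half (K : numFieldType) (V : lmodType K) (v : V) :
  2^-1 *: (v + v) = v.
Proof.
by rewrite -mulr2n -scaler_nat scalerA mulVf ?scale1r // pnatr_eq0.
Qed.

(** Compressing the Lyapunov operator between left eigenspaces turns it into the
    scalar [l + m]. *)
Lemma sandwich_lyapunov (K : comPzRingType) n (A D L M : 'M[K]_n) (l m : K) :
  L *m A = l *: L -> M *m A = m *: M ->
  L *m (A *m D + D *m A^T) *m M^T = (l + m) *: (L *m D *m M^T).
Proof.
move=> LA MA; rewrite mulmxDr mulmxDl scalerDl mulmxA LA -!scalemxAl.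
by congr (_ + _); rewrite mulmxA -mulmxA -trmx_mul MA trmxZ -scalemxAr.
Qed.

(** The eigenvalues [l] and [- l] of the two factors cancel in the Lyapunov
    operator, and only the defect [p e] of the second factor survives. *)
Lemma lyapunov_rank1 (K : fieldType) n (A : 'M[K]_n) (x x' e : 'cV[K]_n)
    (l d p : K) :
  p != 0 -> A *m x = l *: x -> A *m x' = - l *: x' - p *: e ->
  A *m ((d * p)^-1 *: (x *m x'^T)) + (d * p)^-1 *: (x *m x'^T) *m A^T
    = - (d^-1 *: x *m e^T).
Proof.
move=> p0 Ax Ax'; rewrite -scalemxAr -scalemxAl mulmxA Ax -mulmxA -trmx_mul Ax'.
rewrite linearB /= !trmxZ mulmxBr -!scalemxAl -!scalemxAr -scalerDr.
by rewrite scaleNr addrA subrr add0r scalerN scalerA invfM mulfVK.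
Qed.

Lemma mul_rank1_involution (K : fieldType) n (J : 'M[K]_n) (x y : 'cV[K]_n)
    (k k' c : K) :
  J *m J = 1%:M -> y^T *m x = c%:M ->
  - (k *: (x *m x^T *m J)) *m (k' *: (J *m y *m y^T))
    = - (k * k' * c) *: (x *m y^T).
Proof.
move=> JJ yx; rewrite mulNmx -scalemxAl -scalemxAr -!mulmxA (mulmxA J J) JJ.
rewrite mul1mx (mulmxA x^T) -[y in x^T *m y]trmxK -trmx_mul yx tr_scalar_mx.
by rewrite mul_scalar_mx -scalemxAr !scalerA !mulrA scaleNr.
Qed.

(** In [hatPinv2E] the left factor ends with [x^T] and carries no [J], so a single
    [J] remains between [x] and [y]. *)
Lemma mul_rank1_bridge (K : fieldType) n (J : 'M[K]_n) (u x y : 'cV[K]_n)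
    (k k' c : K) :
  x^T *m J *m y = c%:M ->
  (k *: (u *m x^T)) *m (k' *: (J *m y *m y^T)) = (k * k' * c) *: (u *m y^T).
Proof.
move=> xJy; rewrite -scalemxAl -scalemxAr -!mulmxA (mulmxA J) (mulmxA x^T).
by rewrite (mulmxA x^T) xJy mul_scalar_mx -scalemxAr !scalerA !mulrA.
Qed.

Lemma scalar_residue (K : fieldType) (d p : K) : d != 0 -> p != 0 ->
  - ((d * p)^-1 * (p / - d) * (1 * - d)) = (- d)^-1.
Proof. by move=> d0 p0; field; rewrite oppr_eq0 d0 p0. Qed.

Lemma scalar_hatPinv2 (K : fieldType) (w v d d' s : K) :
  (w * v) / - (d * d') * s^-1 = (- d)^-1 * (v / - d') * (w / - s).
Proof. by rewrite !invrN invfM; ring. Qed.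

(** * Conjugation *)

Lemma conj_Npoly (R : rcfType) n (a : n.-tuple R) (z : R[i]) :
  ((Npoly a).[z])^* = (Npoly a).[z^*].
Proof.
rewrite -horner_map NpolyE -map_poly_comp; congr (_.[_]).
by apply: eq_map_poly => x; apply: conjc_real.
Qed.

Lemma conj_Npoly_deriv (R : rcfType) n (a : n.-tuple R) (z : R[i]) :
  ((Npoly a)^`().[z])^* = (Npoly a)^`().[z^*].
Proof.
rewrite -horner_map NpolyE deriv_map -map_poly_comp; congr (_.[_]).
by apply: eq_map_poly => x; apply: conjc_real.
Qed.

Lemma conj_xvec (R : rcfType) n (z : R[i]) :
  (xvec n z)^t* = (xvec n (z^*))^T.
Proof. by apply/rowP => r; rewrite !mxE rmorphXn. Qed.

Lemma conjT_Rmx (R : rcfType) n (a : n.-tuple R) (l : R[i]) :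
  (Rmx a l)^t* = (- (Npoly a)^`().[l^*])^-1
    *: (((yvec a l)^t*)^T *m (xvec n (l^*))^T).
Proof.
rewrite /Rmx trmxZ trmx_mul trmxK map_mxZ map_mxM conj_xvec.
rewrite map_trmx trmxK fmorphV rmorphN; congr ((- _)^-1 *: _).
exact: conj_Npoly_deriv.
Qed.

(** * The dual eigenvector bases *)

Section SpectralData.

Variables (R : rcfType) (n : nat) (a : n.-tuple R) (lambda : 'I_n -> R[i]).
Hypothesis lambda_eig :
  forall j : 'I_n, eigenvalue (cmx (companion a)) (lambda j).
Hypothesis lambda_inj : injective lambda.
Hypothesis lambda_add : forall i j : 'I_n, lambda i + lambda j != 0.

Let x i := xvec n (lambda i).
Let y i := yvec a (lambda i).
Let A := cmx (companion a).
Let e := cmx (en R n).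

Lemma lambda_neq0 i : lambda i != 0.
Proof.
by have := lambda_add i i; rewrite -mulr2n mulrn_eq0.
Qed.

Lemma lambda_root i : root (Npoly a) (lambda i).
Proof. by rewrite -eigenvalue_root_char. Qed.

Lemma Npoly_roots z : root (Npoly a) z -> exists i, z = lambda i.
Proof.
move=> Nz; have [/existsP[i /eqP ->]|] := boolP [exists i, z == lambda i].
  by exists i.
rewrite negb_exists => /forallP zl.
have N0 : Npoly a != 0 by rewrite -size_poly_gt0 size_Npoly.
have /(max_poly_roots N0) : all (root (Npoly a)) (z :: codom lambda).
  by rewrite /= Nz; apply/allP => _ /codomP[i ->]; apply: lambda_root.
rewrite size_Npoly /= size_codom card_ord ltnn map_inj_uniq ?enum_uniq // andbT.
move=> zN; suff /zN : z \notin codom lambda by [].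
by apply/codomP => -[i zi]; have := zl i; rewrite zi eqxx.
Qed.

Lemma Npoly_opp_neq0 i : (Npoly a).[- lambda i] != 0.
Proof.
apply/negP => /Npoly_roots[j lij].
by have := lambda_add j i; rewrite -lij addNr eqxx.
Qed.

(** The polynomial is real, so the conjugate of an eigenvalue is again one of the
    [lambda k]. *)
Lemma conj_lambda_add_neq0 i j : (lambda i)^* + lambda j != 0.
Proof.
have [k lk] : exists k, (lambda i)^* = lambda k; last first.
  by have := lambda_add k j; rewrite -lk.
by apply: Npoly_roots; rewrite rootE -conj_Npoly (rootP (lambda_root i)) rmorph0.
Qed.

Lemma ypoly_lambda i j : j != i -> (ypoly a (lambda i)).[lambda j] = 0.
Proof.
move=> ji; rewrite ypoly_off ?lambda_neq0 ?lambda_root ?(inj_eq lambda_inj) //.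
by rewrite (rootP (lambda_root j)) oppr0 mul0r.
Qed.

(** Otherwise [ypoly a (lambda i)], whose size is at most [n], would vanish at all
    [n] eigenvalues. *)
Lemma Npoly_deriv_neq0 i : (Npoly a)^`().[lambda i] != 0.
Proof.
rewrite -oppr_eq0 -ypoly_diag ?lambda_neq0 ?lambda_root //.
apply/eqP => qi; set q := ypoly _ _ in qi.
have q0 : q != 0.
  apply/eqP => q0; have := mul_ypoly (lambda_neq0 i) (lambda_root i).
  rewrite -/q q0 mulr0 => /esym/eqP; rewrite oppr_eq0 -size_poly_eq0.
  by rewrite size_Npoly.
have := max_poly_roots (rs := codom lambda) q0.
rewrite size_codom card_ord map_inj_uniq ?enum_uniq //.
suff -> : all (root q) (codom lambda).
  by move/(_ isT isT); rewrite ltnNge size_poly.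
apply/allP => _ /codomP[j ->]; apply/rootP.
by have [->|/ypoly_lambda] := eqVneq j i.
Qed.

Lemma yvec_xvec i j : (y i)^T *m x j =
  ((i == j)%:R * - (Npoly a)^`().[lambda i])%:M.
Proof.
rewrite horner_ypoly ?lambda_neq0 //; congr (_%:M).
have [<-|ij] := eqVneq i j; rewrite ?mul1r ?mul0r.
  by rewrite ypoly_diag ?lambda_neq0 ?lambda_root.
by rewrite ypoly_lambda // eq_sym.
Qed.

Lemma yvec_Rmx i j : (y i)^T *m Rmx a (lambda j) = (i == j)%:R *: (y i)^T.
Proof.
rewrite /Rmx -scalemxAr mulmxA yvec_xvec mul_scalar_mx scalerA.
have [<-|ij] := eqVneq i j; last by rewrite mul0r mulr0 !scale0r.
by rewrite mul1r mulVf ?oppr_eq0 ?Npoly_deriv_neq0.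
Qed.

(** By [yvec_xvec] the rescaled left eigenvectors form a left inverse of the matrix
    of right eigenvectors; for square matrices it is also a right inverse, and that
    product is the sum. *)
Lemma sum_Rmx : \sum_i Rmx a (lambda i) = 1%:M.
Proof.
pose X := \matrix_(r, i) x i r 0.
pose Y := \matrix_(i, r) ((- (Npoly a)^`().[lambda i])^-1 * y i r 0).
have YX : Y *m X = 1%:M.
  apply/matrixP => i j; have /matrixP/(_ 0 0) := yvec_xvec i j.
  rewrite [in LHS]mxE [in RHS]mxE eqxx mulr1n => yx; rewrite [LHS]mxE.
  have -> : \sum_r Y i r * X r j
      = (- (Npoly a)^`().[lambda i])^-1 * \sum_r (y i)^T 0 r * x j r 0.
    rewrite mulr_sumr; apply: eq_bigr => r _.
    by rewrite [Y i r]mxE [X r j]mxE [(y i)^T 0 r]mxE mulrA.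
  by rewrite yx mulrCA mulVf ?oppr_eq0 ?Npoly_deriv_neq0 // mulr1 [RHS]mxE.
rewrite -(mulmx1C YX); apply/matrixP => r c; rewrite summxE [RHS]mxE.
apply: eq_bigr => i _; rewrite [X r i]mxE [Y i c]mxE [LHS]mxE mulrCA.
by congr (_ * _); rewrite [LHS]mxE big_ord1 [_^T _ _]mxE.
Qed.

Lemma companion_x i : A *m x i = lambda i *: x i.
Proof.
by rewrite companion_xvec (rootP (lambda_root i)) scale0r subr0.
Qed.

Lemma companion_Rmx i :
  A *m Rmx a (lambda i) = lambda i *: Rmx a (lambda i).
Proof.
by rewrite /Rmx -scalemxAr mulmxA companion_x -scalemxAl !scalerA mulrC.
Qed.

(** Only the action of the companion matrix on the [x i] is known beforehand; the
    decomposition of the identity transfers it to the left. *)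
Lemma Rmx_companion i :
  Rmx a (lambda i) *m A = lambda i *: Rmx a (lambda i).
Proof.
have yA : (y i)^T *m A = lambda i *: (y i)^T.
  rewrite -[A]mulmx1 -sum_Rmx 2!mulmx_sumr (bigD1 i) //= big1 => [|j ji].
    by rewrite addr0 companion_Rmx -scalemxAr yvec_Rmx eqxx scale1r.
  rewrite companion_Rmx -scalemxAr yvec_Rmx eq_sym (negPf ji).
  by rewrite scale0r scaler0.
by rewrite /Rmx -scalemxAl -mulmxA yA -scalemxAr !scalerA mulrC.
Qed.

(** By [sum_Rmx] it suffices that every block [R_i D R_j^T] vanish, and it is
    multiplied by [lambda i + lambda j] under the Lyapunov operator. *)
Lemma lyapunov_ker (D : 'M_n) : A *m D + D *m A^T = 0 -> D = 0.
Proof.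
move=> AD.
have -> : D = (\sum_i Rmx a (lambda i)) *m D *m (\sum_j Rmx a (lambda j))^T.
  by rewrite sum_Rmx trmx1 mul1mx mulmx1.
rewrite linear_sum mulmx_sumr big1 // => j _.
rewrite !mulmx_suml big1 // => i _.
have := sandwich_lyapunov D (Rmx_companion i) (Rmx_companion j).
rewrite AD mulmx0 mul0mx => /esym/eqP.
by rewrite scaler_eq0 (negPf (lambda_add i j)) => /eqP.
Qed.

Lemma lyapunov_solution_uniq (B S1 S2 : 'M_n) :
  A *m S1 + S1 *m A^T = B -> A *m S2 + S2 *m A^T = B -> S1 = S2.
Proof.
move=> AS1 AS2; apply/subr0_eq/lyapunov_ker.
by rewrite mulmxBr mulmxBl addrACA -opprD AS1 AS2 subrr.
Qed.

(** Row [r] says that the sum of [l_i^r / N'(l_i)] is [1] for [r = n - 1] and [0]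
    below: these are divided differences of a power, by Lagrange interpolation. *)
Lemma sum_xvec : \sum_i ((Npoly a)^`().[lambda i])^-1 *: x i = e.
Proof.
rewrite -[RHS]mul1mx -sum_Rmx mulmx_suml; apply: eq_bigr => i _.
rewrite /Rmx -scalemxAl -mulmxA yvec_last ?lambda_neq0 ?lambda_root //.
by rewrite mul_mx_scalar scalerA invrN mulrN1 opprK.
Qed.

(** * The residues of the Lyapunov solution and of its inverse *)

Lemma hatPE i : hatP a (lambda i)
  = ((Npoly a)^`().[lambda i] * (Npoly a).[- lambda i])^-1
     *: (x i *m (xvec n (- lambda i))^T).
Proof.
rewrite /hatP -mulmxA -[Jmx R n]trmx_Jmx -trmx_mul Jmx_xvec.
by rewrite linearN /= mulmxN scalerN opprK.
Qed.

Lemma lyapunov_hatP :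
  A *m (\sum_i hatP a (lambda i)) + (\sum_i hatP a (lambda i)) *m A^T
    = - (e *m e^T).
Proof.
rewrite mulmx_sumr mulmx_suml -big_split /= -[in RHS]sum_xvec mulmx_suml.
rewrite -sumrN; apply: eq_bigr => i _; rewrite hatPE.
apply: lyapunov_rank1; rewrite ?Npoly_opp_neq0 ?companion_x //.
by rewrite sum_xvec companion_xvec.
Qed.

Lemma hatP_hatPinv i j :
  hatP a (lambda i) *m hatPinv a (lambda j) = (i == j)%:R *: Rmx a (lambda i).
Proof.
rewrite (mul_rank1_involution _ _ (Jmx_sqr R n) (yvec_xvec j i)).
have [<-|ij] := eqVneq i j; last first.
  by rewrite mul0r mulr0 oppr0 !scale0r.
rewrite scale1r; congr (_ *: _).
by apply: scalar_residue; rewrite ?Npoly_deriv_neq0 ?Npoly_opp_neq0.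
Qed.

Lemma sum_hatP_inv :
  (\sum_i hatP a (lambda i)) *m (\sum_j hatPinv a (lambda j)) = 1%:M.
Proof.
rewrite -sum_Rmx mulmx_suml; apply: eq_bigr => i _.
rewrite mulmx_sumr (bigD1 i) //= big1 => [|j ji].
  by rewrite hatP_hatPinv eqxx scale1r addr0.
by rewrite hatP_hatPinv eq_sym (negPf ji) scale0r.
Qed.

(** With [m] the conjugate of [lambda i], the scalar [x_i^* J y_j] is the value at
    [- m] of [- ypoly a (lambda j)], which produces both the factor [N(- m)] and the
    denominator [m + lambda j]. *)
Lemma hatPinv2E i j : hatPinv2 a (lambda i) (lambda j)
  = (Rmx a (lambda i))^t* *m hatPinv a (lambda j).
Proof.
have xJy : (xvec n (lambda i)^*)^T *m Jmx R n *m y j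
    = ((Npoly a).[- (lambda i)^*] / - ((lambda i)^* + lambda j))%:M.
  rewrite -[Jmx R n]trmx_Jmx -trmx_mul Jmx_xvec -[y j]trmxK -trmx_mul mulmxN.
  rewrite horner_ypoly ?lambda_neq0 // ypoly_off ?lambda_neq0 ?lambda_root //.
    by rewrite -raddfN tr_scalar_mx -mulNr opprK opprD.
  by rewrite -subr_eq0 -opprD oppr_eq0 conj_lambda_add_neq0.
rewrite conjT_Rmx (mul_rank1_bridge _ _ _ xJy) /hatPinv2 scalerA.
congr (_ *: _); exact: scalar_hatPinv2.
Qed.

Lemma sum_conjT_Rmx : \sum_i (Rmx a (lambda i))^t* = 1%:M.
Proof.
by rewrite -[RHS](map_mx1 Num.conj) -trmx1 -sum_Rmx !linear_sum /= raddf_sum.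
Qed.

Lemma sum_hatPinv2 j :
  \sum_i hatPinv2 a (lambda i) (lambda j) = hatPinv a (lambda j).
Proof.
rewrite -[RHS]mul1mx -sum_conjT_Rmx mulmx_suml.
by apply: eq_bigr => i _; rewrite hatPinv2E.
Qed.

(** The common kernel of the [hatP a (lambda i)] lies in the kernel of their sum,
    which is invertible. *)
Lemma hatP_inj (Q1 Q2 : 'M_n) :
  (forall i, hatP a (lambda i) *m Q1 = hatP a (lambda i) *m Q2) -> Q1 = Q2.
Proof.
move=> Q12; have /mulmx1C IP := sum_hatP_inv.
rewrite -[Q1]mul1mx -[Q2]mul1mx -IP -!mulmxA; congr (_ *m _).
by rewrite !mulmx_suml; apply: eq_bigr => i _.
Qed.

End SpectralData.

(** * Real solutions *)

Section RealSolution.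

Variables (R : rcfType) (n : nat) (a : n.-tuple R).

Let A := cmx (companion a).
Let e := cmx (en R n).

Lemma cmx_inj : injective (@cmx R n n).
Proof. exact: map_mx_inj. Qed.

Lemma conj_cmx m k (M : 'M[R]_(m, k)) : map_mx Num.conj (cmx M) = cmx M.
Proof. by apply/matrixP => r c; rewrite !mxE; apply: conjc_real. Qed.

Lemma conj_invariant_cmx (S : 'M[R[i]]_n) :
  map_mx Num.conj S = S -> exists P, cmx P = S.
Proof.
move=> S_real; exists (map_mx (@complex.Re R) S).
apply/matrixP => r c; rewrite !mxE; apply: RRe_real.
by apply/CrealP; move/matrixP/(_ r c): S_real; rewrite mxE.
Qed.

Lemma lyapunov_cmx (P : 'M[R]_n) :
  lyapunov a P <-> A *m cmx P + cmx P *m A^T = - (e *m e^T).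
Proof.
have -> : A *m cmx P + cmx P *m A^T
    = cmx (companion a *m P + P *m (companion a)^T).
  by rewrite /cmx map_mxD !map_mxM map_trmx.
have -> : - (e *m e^T) = cmx (- (en R n *m (en R n)^T)).
  by rewrite /cmx map_mxN map_mxM map_trmx.
by split=> [-> //|/cmx_inj].
Qed.

Lemma lyapunov_tr (P : 'M[R]_n) : lyapunov a P -> lyapunov a P^T.
Proof.
rewrite /lyapunov => /(congr1 trmx).
by rewrite linearD linearN /= !trmx_mul !trmxK addrC.
Qed.

Lemma lyapunov_riccati (P : 'M[R]_n) :
  P \in unitmx -> lyapunov a P -> riccati a (invmx P).
Proof.
move=> Pu /(congr1 (fun M => invmx P *m M *m invmx P)).
rewrite /riccati mulmxDr mulmxDl !mulmxA mulVmx // mul1mx mulmxK //.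
by rewrite mulmxN mulNmx !mulmxA.
Qed.

End RealSolution.

Lemma herm_part_cmx (R : rcfType) n (M : 'M[R]_n) :
  M^T = M -> herm_part (cmx M) = cmx M.
Proof.
move=> M_sym; rewrite /herm_part -map_trmx conj_cmx /cmx map_trmx M_sym.
exact: scaler_half.
Qed.

(** * The expansion of the inverse solution *)

Theorem theorem4 (R : realType) (n : nat) (a : n.-tuple R)
    (lambda : 'I_n -> R[i])
    (n_gt0 : (0 < n)%N)
    (lambda_eig : forall j : 'I_n, eigenvalue (cmx (companion a)) (lambda j))
    (lambda_inj : injective lambda)
    (lambda_add : forall i j : 'I_n, lambda i + lambda j != 0) :
  [/\ exists! P : 'M[R]_n, lyapunov a P,
      forall P : 'M[R]_n, lyapunov a P ->
        [/\ P \in unitmx,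
            riccati a (invmx P),
            cmx (invmx P) = \sum_j tildePinv a (lambda j),
            cmx (invmx P) = \sum_j hatPinv a (lambda j)
          & cmx (invmx P) = \sum_i \sum_j hatPinv2 a (lambda i) (lambda j)],
      forall j : 'I_n,
        hatPinv a (lambda j) = \sum_i hatPinv2 a (lambda i) (lambda j),
      forall i j : 'I_n,
        hatP a (lambda i) *m hatPinv a (lambda j)
          = (i == j)%:R *: Rmx a (lambda i)
    & (forall i j : 'I_n,
        hatPinv2 a (lambda i) (lambda j)
          = (Rmx a (lambda i)) ^t* *m hatPinv a (lambda j))
      /\
      (forall Q : 'I_n -> 'M[R[i]]_n,
        (forall i j : 'I_n,
           hatP a (lambda i) *m Q j = (i == j)%:R *: Rmx a (lambda i)) ->
        (forall j : 'I_n, Q j = hatPinv a (lambda j)) /\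
        (forall i j : 'I_n,
           (Rmx a (lambda i)) ^t* *m Q j
             = hatPinv2 a (lambda i) (lambda j)))].
Proof.
pose S := \sum_i hatP a (lambda i).
have S_lyap := lyapunov_hatP lambda_eig lambda_inj lambda_add.
have S_uniq := lyapunov_solution_uniq lambda_eig lambda_inj lambda_add.
have S_inv := sum_hatP_inv lambda_eig lambda_inj lambda_add.
have hatPinv2E := hatPinv2E lambda_eig lambda_inj lambda_add.
have sum_hatPinv2 := sum_hatPinv2 lambda_eig lambda_inj lambda_add.
have hatP_hatPinv := hatP_hatPinv lambda_eig lambda_inj lambda_add.
have hatP_inj := hatP_inj lambda_eig lambda_inj lambda_add.
have cmx_sol P : lyapunov a P -> cmx P = S.
  by move/lyapunov_cmx => P_lyap; apply: S_uniq P_lyap S_lyap.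
have [P0 P0S] : exists P, cmx P = S.
  (* the conjugate of S solves the same equation, whose data are real *)
  apply/conj_invariant_cmx/S_uniq/S_lyap.
  move/(congr1 (map_mx Num.conj)): S_lyap.
  by rewrite map_mxD map_mxN !map_mxM -!map_trmx !conj_cmx.
have P0_lyap : lyapunov a P0 by apply/lyapunov_cmx; rewrite P0S.
split=> [|P P_lyap|j|i j|].
- exists P0; split=> // P P_lyap; apply: cmx_inj; by rewrite P0S cmx_sol.
- have [Su _] := mulmx1_unit S_inv.
  have Pu : P \in unitmx.
    by rewrite -(map_unitmx (real_complex R)) [map_mx _ _]cmx_sol.
  have invP : cmx (invmx P) = \sum_j hatPinv a (lambda j).
    rewrite /cmx map_invmx [map_mx _ P]cmx_sol //.
    by rewrite -[LHS]mulmx1 -S_inv mulKmx.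
  have P_sym : P^T = P.
    by apply: cmx_inj; rewrite !cmx_sol //; apply: lyapunov_tr.
  split=> //; first exact: lyapunov_riccati.
    have -> : \sum_j tildePinv a (lambda j) = herm_part (cmx (invmx P)).
      rewrite /herm_part invP !linear_sum /= raddf_sum -big_split /=.
      by rewrite scaler_sumr.
    by rewrite herm_part_cmx // trmx_inv P_sym.
  by rewrite invP exchange_big; apply: eq_bigr => j _; rewrite sum_hatPinv2.
- by rewrite sum_hatPinv2.
- exact: hatP_hatPinv.
split=> [i j|Q HQ]; first exact: hatPinv2E.
have QE j : Q j = hatPinv a (lambda j).
  by apply: hatP_inj => i; rewrite HQ hatP_hatPinv.
by split=> [j|i j]; rewrite QE // hatPinv2E.
Qed.
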